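(* Let $d\ge 1$, let $d_e$ be the Euclidean metric on $\mathbb{R}^d$, and let $\mu$ be an arbitrary non-negative Borel measure on $\mathbb{R}^d$ such that $0<\mu(B)<\infty$ for every open Euclidean ball $B$. Then the centered maximal operator $M^c$ associated with $(\mathbb{R}^d,d_e,\mu)$ possesses the dichotomy property if and only if there exists $y_0\in\mathbb{R}^d$ such that $$\limsup_{r\to\infty}\frac{\mu(B_{r+1}(y_0))}{\mu(B_r(y_0))}<\infty.$$
   Context: $B_r(x)$ denotes the open Euclidean ball in $\mathbb{R}^d$ with center $x$ and radius $r>0$. $L^1_{loc}(\mu)$ is the space of measurable functions $f$ on $\mathbb{R}^d$ with $\int_B|f|\,d\mu<\infty$ for every open ball $B$. For $f\in L^1_{loc}(\mu)$ and $x\in\mathbb{R}^d$ define $$M^cf(x)=\sup_{r>0}\frac{1}{\mu(B_r(x))}\int_{B_r(x)}|f|\,d\mu,$$ and let $E^c_\infty(f)=\{x\in \mathbb{R}^d: M^cf(x)=\infty\}$. $M^c$ possesses the dichotomy property if for every $f\in L^1_{loc}(\mu)$ either $\mu(E^c_\infty(f))=0$ or $E^c_\infty(f)=\mathbb{R}^d$. *)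

(* Defs.v *)
From HB Require Import structures.
From mathcomp Require Import all_boot all_order all_algebra.
From mathcomp Require Import all_classical all_reals all_analysis.
Import Order.TTheory GRing.Theory Num.Theory.
Import numFieldNormedType.Exports.

Set Implicit Arguments.
Unset Strict Implicit.
Unset Printing Implicit Defensive.

Local Open Scope classical_set_scope.
Local Open Scope ring_scope.

(* Row vectors with the Borel sigma-algebra.  The library topology on 'rV[R]_d
   is that of the sup norm, which is also the Euclidean one. *)
Notation borel_rV R d := (g_sigma_algebraType (@open 'rV[R]_d)).

(* The library norm on 'rV[R]_d is the sup norm, whose balls are cubes; the
   Euclidean metric has to be introduced separately. *)
Definition euclidean_dist (R : realType) (d : nat) (x y : 'rV[R]_d) : R :=
  Num.sqrt (\sum_(i < d) (x 0 i - y 0 i) ^+ 2).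

Definition euclidean_ball (R : realType) (d : nat) (x : 'rV[R]_d) (r : R)
    : set (borel_rV R d) :=
  [set y | euclidean_dist x y < r].

Local Open Scope ereal_scope.

Section maximal_operator.
Variables (R : realType) (d : nat).
Variable mu : {measure set (borel_rV R d) -> \bar R}.
Implicit Types (f : borel_rV R d -> R) (x : 'rV[R]_d).

Definition L1_loc f : Prop :=
  measurable_fun [set: borel_rV R d] f /\
  forall x (r : R), (0 < r)%R ->
    \int[mu]_(y in euclidean_ball x r) `|f y|%:E < +oo.

Definition centered_maximal f x : \bar R :=
  ereal_sup [set (mu (euclidean_ball x r))^-1 *
                 \int[mu]_(y in euclidean_ball x r) `|f y|%:E
            | r in [set r : R | (0 < r)%R]].

Definition infinity_set f : set (borel_rV R d) :=
  [set x | centered_maximal f x = +oo].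

Definition dichotomy_property : Prop :=
  forall f, L1_loc f ->
    mu (infinity_set f) = 0 \/ infinity_set f = [set: borel_rV R d].

End maximal_operator.

(* Main.v *)
Require Import Defs.
From HB Require Import structures.
From mathcomp Require Import all_boot all_order all_algebra finmap.
From mathcomp Require Import all_classical all_reals all_analysis.
From mathcomp Require Import ring lra measurable_realfun.
Import Order.TTheory GRing.Theory Num.Theory.
Import numFieldNormedType.Exports.

Local Open Scope classical_set_scope.
Local Open Scope ring_scope.

(* If mu (B_{r+1} y0) <= C mu (B_r y0) for large r, then the averages of |f| over
   B_r x and B_r x0 are comparable for large r, so finiteness of M f at one point
   x0 leaves only bounded radii to consider near any x.  For those |f| can be
   truncated to a ball, and a weak type (1,1) bound, which holds for every mu by a
   Besicovitch covering argument, makes {M f = +oo} negligible.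

   If the growth condition fails at 0, there are a unit vector e and radii r_k
   tending to infinity for which mu (B_{r_k - 1} (4 e)) / mu (B_{r_k} 0) grows as
   fast as desired.  Put mass about mu (B_{r_k - 1} (4 e)) / 2^k close to
   - (r_k - 1) e: seen from 4 e this mass enters too late to be noticed, while near
   0 it makes the averages over balls of radius about r_k unbounded. *)

(** * The Euclidean norm, its open balls, and finite nets *)

Section euclidean_norm.
Context {R : realType} {d : nat}.
Implicit Types (u v x y z : 'rV[R]_d) (r s : R).

Definition enorm v : R := Num.sqrt (\sum_(i < d) (v 0 i) ^+ 2).

Lemma euclidean_distE x y : euclidean_dist x y = enorm (x - y).
Proof.
by rewrite /euclidean_dist /enorm; congr Num.sqrt; apply: eq_bigr => i _; rewrite !mxE.
Qed.

Lemma euclidean_ballE x r y : (euclidean_ball x r y) = (enorm (x - y) < r) :> Prop.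
Proof. by rewrite /euclidean_ball /= euclidean_distE. Qed.

Lemma enorm_ge0 v : 0 <= enorm v.
Proof. exact: sqrtr_ge0. Qed.

Lemma sqr_enorm v : enorm v ^+ 2 = \sum_(i < d) (v 0 i) ^+ 2.
Proof. by rewrite sqr_sqrtr // sumr_ge0 // => i _; exact: sqr_ge0. Qed.

Lemma enormZ a v : enorm (a *: v) = `|a| * enorm v.
Proof.
rewrite /enorm -sqrtr_sqr -sqrtrM ?sqr_ge0// mulr_sumr; congr Num.sqrt.
by apply: eq_bigr => i _; rewrite mxE exprMn.
Qed.

Lemma enormN v : enorm (- v) = enorm v.
Proof. by rewrite -scaleN1r enormZ normrN1 mul1r. Qed.

Lemma enorm_distC x y : enorm (x - y) = enorm (y - x).
Proof. by rewrite -enormN opprB. Qed.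

Lemma enorm0 : enorm 0 = 0.
Proof. by rewrite -(scale0r 0) enormZ normr0 mul0r. Qed.

Lemma enorm_eq0 v : (enorm v == 0) = (v == 0).
Proof.
apply/eqP/eqP => [v0|->]; last exact: enorm0.
have := sqr_enorm v; rewrite v0 expr0n /= => /esym/eqP.
rewrite psumr_eq0 => [|i _]; last exact: sqr_ge0.
move=> /allP v_eq0; apply/rowP => i; rewrite mxE; apply/eqP.
by rewrite -sqrf_eq0; apply: v_eq0; rewrite mem_index_enum.
Qed.

Lemma norm_coord_le_enorm v i : `|v 0 i| <= enorm v.
Proof.
rewrite -(ler_pXn2r (_ : 0 < 2)%N) ?nnegrE ?enorm_ge0// sqr_enorm.
rewrite real_normK ?num_real// (bigD1 i)//= lerDl.
by apply: sumr_ge0 => j _; exact: sqr_ge0.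
Qed.

(** Cauchy-Schwarz: for nonzero vectors, the sum of the squares of [B * u 0 i - A * v 0 i] expands
    to [2 * (A * B) * (A * B - S)]. *)
Lemma dot_le_enorm u v : \sum_(i < d) u 0 i * v 0 i <= enorm u * enorm v.
Proof.
set S := \sum_(i < d) _; set A := enorm u; set B := enorm v.
have [u0|u_neq0] := eqVneq u 0.
  rewrite /A u0 enorm0 mul0r /S u0 big1// => i _; by rewrite mxE mul0r.
have [v0|v_neq0] := eqVneq v 0.
  rewrite /B v0 enorm0 mulr0 /S v0 big1// => i _; by rewrite mxE mulr0.
have A0 : 0 < A by rewrite lt_neqAle eq_sym enorm_eq0 u_neq0 enorm_ge0.
have B0 : 0 < B by rewrite lt_neqAle eq_sym enorm_eq0 v_neq0 enorm_ge0.
have : 0 <= \sum_(i < d) (B * u 0 i - A * v 0 i) ^+ 2.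
  by apply: sumr_ge0 => i _; exact: sqr_ge0.
have -> : \sum_(i < d) (B * u 0 i - A * v 0 i) ^+ 2
    = 2 * (A * B) * (A * B - S).
  have -> : 2 * (A * B) * (A * B - S)
      = B ^+ 2 * A ^+ 2 - 2 * (A * B) * S + A ^+ 2 * B ^+ 2 by ring.
  rewrite [X in _ * X - _](sqr_enorm u) [X in _ + _ * X](sqr_enorm v).
  rewrite /S !mulr_sumr -sumrB -big_split/=; apply: eq_bigr => i _.
  by ring.
by rewrite pmulr_rge0 ?subr_ge0// mulr_gt0// mulr_gt0.
Qed.

Lemma ler_enormD u v : enorm (u + v) <= enorm u + enorm v.
Proof.
rewrite -(ler_pXn2r (_ : 0 < 2)%N) ?nnegrE ?addr_ge0 ?enorm_ge0//.
rewrite sqrrD !sqr_enorm.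
have -> : \sum_(i < d) (u + v) 0 i ^+ 2 =
    \sum_(i < d) u 0 i ^+ 2 + (\sum_(i < d) u 0 i * v 0 i) *+ 2 +
    \sum_(i < d) v 0 i ^+ 2.
  under eq_bigr do rewrite mxE sqrrD.
  by rewrite !big_split.
by rewrite lerD2r lerD2l lerMn2r dot_le_enorm orbT.
Qed.

Lemma ler_enorm_dist y x z : enorm (x - z) <= enorm (x - y) + enorm (y - z).
Proof. by rewrite -(subrKA y x (- z)); exact: ler_enormD. Qed.

Lemma enorm_unit u : u != 0 -> enorm ((enorm u)^-1 *: u) = 1.
Proof.
move=> u0; rewrite enormZ ger0_norm ?invr_ge0 ?enorm_ge0//.
by rewrite mulVf// enorm_eq0.
Qed.

Lemma euclidean_ballS x y r s : enorm (x - y) + r <= s ->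
  (euclidean_ball x r `<=` euclidean_ball y s)%classic.
Proof.
move=> xys z; rewrite !euclidean_ballE => xz.
have := ler_enorm_dist x y z; rewrite (enorm_distC y x); lra.
Qed.

Lemma continuous_euclidean_dist x : continuous (euclidean_dist x).
Proof.
move=> y; rewrite /euclidean_dist.
apply: (@continuous_comp _ _ _
  (fun y : 'rV[R]_d => \sum_(i < d) (x 0 i - y 0 i) ^+ 2) Num.sqrt);
  last exact: sqrt_continuous.
apply: (@cvg_big _ _ +%R 0 xpredT _ 'rV[R]_d (nbhs y) _
  (fun i (y : 'rV[R]_d) => (x 0 i - y 0 i) ^+ 2)).
  exact: add_continuous.
move=> i _; by apply: cvgM; (apply: cvgB; [exact: cvg_cst|exact: coord_continuous]).
Qed.

Lemma open_euclidean_ball x r : open (euclidean_ball x r : set 'rV[R]_d).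
Proof.
apply: (open_comp (f := euclidean_dist x)) (open_lt (y := r)) => y _.
exact: continuous_euclidean_dist.
Qed.

Lemma measurable_euclidean_ball x r : measurable (euclidean_ball x r).
Proof. by apply: sub_sigma_algebra; exact: open_euclidean_ball. Qed.

(** The library norm is the sup norm, which the Euclidean norm dominates; so the set is bounded, and
    it is closed as a preimage. *)
Lemma compact_closed_enorm_ball (M : R) :
  compact [set x : 'rV[R]_d | enorm x <= M].
Proof.
apply: bounded_closed_compact.
  exists M; split; first exact: num_real.
  move=> K MK x /= xM; rewrite [leLHS]mx_normrE.
  apply/bigmax_leP; split=> /=.
    exact: le_trans (enorm_ge0 x) (le_trans xM (ltW MK)).
  move=> [i j] _ /=; rewrite (ord1 i).
  exact: le_trans (norm_coord_le_enorm x j) (le_trans xM (ltW MK)).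
have -> : [set x : 'rV[R]_d | enorm x <= M] =
    euclidean_dist 0 @^-1` [set y | y <= M].
  by apply/seteqP; split=> x; rewrite /= euclidean_distE sub0r enormN.
have /continuous_closedP dc := @continuous_euclidean_dist 0.
exact: dc (@closed_le _ M).
Qed.

(** The closure of [A] is compact, and balls of radius [eta] centred in [A] itself already cover it,
    so the net can be taken inside [A]. *)
Lemma finite_net (A : set 'rV[R]_d) (M eta : R) : 0 < eta ->
    (forall x, A x -> enorm x <= M) ->
  exists s : seq 'rV[R]_d, (forall c, c \in s -> A c) /\
    forall x, A x -> exists2 c, c \in s & enorm (x - c) < eta.
Proof.
move=> eta0 AM.
have : compact (closure A).
  apply: subclosed_compact (@compact_closed_enorm_ball M) _.
    exact: closed_closure.
  have /closure_id -> : closed [set x : 'rV[R]_d | enorm x <= M].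
    exact: compact_closed (@compact_closed_enorm_ball M).
  exact: closureS.
rewrite compact_cover => /(_ 'rV[R]_d A
  (fun c => euclidean_ball c eta : set 'rV[R]_d)) [].
- by move=> c _; exact: open_euclidean_ball.
- move=> x cAx; have [|y [Ay xy]] := cAx (euclidean_ball x eta).
    apply: open_nbhs_nbhs; split; first exact: open_euclidean_ball.
    by rewrite euclidean_ballE subrr enorm0.
  exists y => //.
  by move: xy; rewrite !euclidean_ballE enorm_distC.
- move=> s sA scover; exists s; split; first by move=> c /sA; rewrite inE.
  move=> x Ax; have [c /= cs] := scover x (subset_closure Ax).
  by rewrite euclidean_ballE enorm_distC => ?; exists c.
Qed.

End euclidean_norm.

(** * Besicovitch covering: greedy selection and bounded overlap *)

Section besicovitch.
Context {R : realType} {d : nat}.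
Implicit Types (a b c x z : 'rV[R]_d).

Definition separated (I : eqType) (x : I -> 'rV[R]_d) (rho : I -> R)
    (s : seq I) := uniq s /\
  {in s &, forall i j, i != j -> Num.max (rho i) (rho j) <= enorm (x i - x j)}.

(* Greedy selection: keep a ball of largest radius, drop the balls whose centres
   it contains, and repeat. *)
Lemma greedy_selection (I : eqType) (x : I -> 'rV[R]_d) (rho : I -> R)
    (s : seq I) : {in s, forall i, 0 < rho i} ->
  exists t : seq I, [/\ {subset t <= s}, separated _ x rho t &
    {in s, forall j, exists2 i, i \in t & enorm (x i - x j) < rho i}].
Proof.
pose ge_rho i j := rho j <= rho i.
have trg : transitive ge_rho by move=> j i k ij jk; exact: le_trans jk ij.
move=> rho0.
suff [t [ts tsep tcov]] : exists t : seq I,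
    [/\ {subset t <= sort ge_rho s}, separated _ x rho t &
    {in sort ge_rho s, forall j, exists2 i, i \in t & enorm (x i - x j) < rho i}].
  exists t; split=> //.
    by move=> i /ts; rewrite mem_sort.
  by move=> j js; apply: tcov; rewrite mem_sort.
have : sorted ge_rho (sort ge_rho s) by apply: sort_sorted => i j; exact: le_total.
have : {in sort ge_rho s, forall i, 0 < rho i}.
  by move=> i; rewrite mem_sort; exact: rho0.
(* Induction on a size bound, since the recursive call is on a filtered tail. *)
have [n] := ubnP (size (sort ge_rho s)).
elim: n (sort ge_rho s) => // n IH [|i s'] /= sn s'0 sorted_s'.
  by exists [::]; split.
pose s'' := [seq j <- s' | rho i <= enorm (x i - x j)].
have s''s' : {subset s'' <= s'} by move=> j; rewrite mem_filter => /andP[].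
have [t [ts [tuniq tsep] tcov]] : exists t : seq I,
    [/\ {subset t <= s''}, separated _ x rho t &
    {in s'', forall j, exists2 i, i \in t & enorm (x i - x j) < rho i}].
  apply: IH.
  - by rewrite (leq_ltn_trans _ (sn : (size s' < n)%N))// size_filter count_size.
  - by move=> j /s''s' js'; apply: s'0; rewrite inE js' orbT.
  - exact/sorted_filter/(path_sorted sorted_s').
(* The list is sorted by decreasing radius, so the maximum is [rho i], and the filter kept only
   centres at least that far away. *)
have far j : j \in t -> Num.max (rho i) (rho j) <= enorm (x i - x j).
  move=> /ts; rewrite mem_filter => /andP[ij js'].
  rewrite ge_max ij; apply: le_trans ij.
  by have /allP/(_ _ js') := order_path_min trg sorted_s'.
exists (i :: t); split.
- move=> j; rewrite !inE => /predU1P[->|/ts/s''s' ->]; rewrite ?eqxx ?orbT//.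
- split.
    rewrite /= tuniq andbT; apply/negP => /far.
    rewrite subrr enorm0 maxxx leNgt s'0//.
    by rewrite inE eqxx.
  move=> j k; rewrite !inE => /predU1P[->|jt] /predU1P[->|kt].
  + by rewrite eqxx.
  + by move=> _; exact: far.
  + by move=> _; rewrite maxC enorm_distC; exact: far.
  + exact: tsep.
- move=> j; rewrite inE => /predU1P[->|js'].
    by exists i; rewrite ?inE ?eqxx// subrr enorm0 s'0// inE eqxx.
  have [ij|ij] := leP (rho i) (enorm (x i - x j)).
    have [|k kt jk] := tcov j; first by rewrite mem_filter ij.
    by exists k; rewrite // inE kt orbT.
  by exists i; rewrite // inE eqxx.
Qed.

(** The zero vector has direction 0; the net in [bounded_overlap] is therefore taken in the closed
    unit ball, not on the sphere. *)
Let dir a := (enorm a)^-1 *: a.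

(** Write [b - a] as [(enorm b - enorm a) *: dir b + enorm a *: (dir b - dir a)]. If the directions
    were closer than 1, the triangle inequality would give [enorm (b - a) <= enorm b]. *)
Lemma dir_separated a b : a != 0 -> enorm a <= enorm b ->
  enorm b < enorm (b - a) -> 1 <= enorm (dir b - dir a).
Proof.
move=> a0 ab bba; rewrite leNgt; apply/negP => dir1.
have na : 0 < enorm a by rewrite lt_neqAle eq_sym enorm_eq0 a0 enorm_ge0.
have nb : 0 < enorm b by exact: lt_le_trans ab.
have b0 : b != 0 by rewrite -enorm_eq0 gt_eqF.
have ea : a = enorm a *: dir a by rewrite scalerA mulfV ?scale1r// gt_eqF.
have eb : b = enorm b *: dir b by rewrite scalerA mulfV ?scale1r// gt_eqF.
have : b - a = (enorm b - enorm a) *: dir b + enorm a *: (dir b - dir a).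
  by rewrite [in LHS]ea [in LHS]eb scalerBl scalerBr addrA subrK.
move/(congr1 enorm) => baE; move: bba; rewrite baE ltNge => /negP; apply.
apply: le_trans (ler_enormD _ _) _.
have ub : enorm (dir b) = 1 by exact: enorm_unit.
rewrite (enormZ _ (dir b)) (enormZ _ (dir b - dir a)) ub mulr1 ger0_norm ?subr_ge0// ger0_norm ?enorm_ge0//.
rewrite -lerBrDl opprB addrCA subrr addr0.
by rewrite ler_piMr ?enorm_ge0// ltW.
Qed.

(** Seen from [z], the centres of separated balls containing [z] have directions at mutual distance
    at least 1. Distinct balls are thus sent to distinct points of a fixed 1/2-net, whose size is
    the bound. *)
Lemma bounded_overlap : exists N : nat, forall (I : eqType)
    (x : I -> 'rV[R]_d) (rho : I -> R) (s : seq I), separated _ x rho s ->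
  forall z, (count (fun i => (enorm (x i - z) < rho i)%R) s <= N)%N.
Proof.
have [|net [_ netP]] :=
    @finite_net R d [set u | enorm u <= 1] 1 2^-1 _ (fun _ => id); first lra.
exists (size net) => I x rho s [suniq ssep] z.
rewrite -size_filter; set s' := [seq _ <- s | _].
have dir_net i : exists c, c \in net /\ enorm (dir (x i - z) - c) < 2^-1.
  have [|c cnet ic] := netP (dir (x i - z)); last by exists c.
  rewrite /=; have [->|/enorm_unit ->//] := eqVneq (x i - z) 0.
  by rewrite /dir scaler0 enorm0.
have [c cP] := choice dir_net.
rewrite -(size_map c); apply: uniq_leq_size; last first.
  by move=> _ /mapP[i _ ->]; have [] := cP i.
rewrite map_inj_in_uniq ?filter_uniq// => i j.
rewrite !mem_filter => /andP[iz si] /andP[jz sj] cij.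
apply/eqP/negP => /negP ij.
have : 1 <= enorm (dir (x j - z) - dir (x i - z)).
  wlog le_ij : i j iz si jz sj cij ij / enorm (x i - z) <= enorm (x j - z).
    move=> wl; have [ij'|/ltW ij'] := leP (enorm (x i - z)) (enorm (x j - z)).
      exact: wl.
    by rewrite enorm_distC; apply: wl; rewrite // eq_sym.
  have ltij : enorm (x j - z) < enorm (x j - x i).
    apply: lt_le_trans jz _; rewrite enorm_distC.
    by apply: le_trans (ssep _ _ si sj ij); rewrite le_max lexx orbT.
  (* A centre equal to [z] would turn [ltij] into a strict inequality of a number with itself. *)
  have [xiz|xiz] := eqVneq (x i - z) 0.
    by move: ltij; rewrite (eqP (_ : x i == z)) ?ltxx// -subr_eq0 xiz.
  apply: dir_separated => //.
  by rewrite opprB addrA subrK.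
apply/negP; rewrite -ltNge.
have [_ h1] := cP j; have [_ h2] := cP i.
have := ler_enorm_dist (c i) (dir (x j - z)) (dir (x i - z)).
rewrite (enorm_distC (c i)); rewrite -cij in h1.
lra.
Qed.

End besicovitch.

(** * The weak type (1,1) bound *)

Local Open Scope ereal_scope.

Lemma measure_bigsetU_le {dd} {T : measurableType dd} {R : realType}
    (mu : {measure set T -> \bar R}) (I : Type) (s : seq I) (F : I -> set T) :
  (forall i, measurable (F i)) ->
  mu (\big[setU/set0]_(i <- s) F i) <= \sum_(i <- s) mu (F i).
Proof.
move=> mF; elim: s => [|i s IH]; first by rewrite !big_nil measure0.
rewrite !big_cons; apply: le_trans (leeD2l _ IH).
by apply: measureU2 => //; exact: bigsetU_measurable.
Qed.

Section weak_type.
Context {R : realType} {d : nat}.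
Variables (mu : {measure set (borel_rV R d) -> \bar R}) (g : borel_rV R d -> \bar R).
Hypotheses (mg : measurable_fun setT g) (g0 : forall x, 0 <= g x).
Implicit Types (x y : 'rV[R]_d) (r s : R).

Lemma integral_ball_le x y r s : (enorm (x - y) + r <= s)%R ->
  \int[mu]_(z in euclidean_ball x r) g z <= \int[mu]_(z in euclidean_ball y s) g z.
Proof.
move=> xys; apply: ge0_subset_integral => //; try exact: measurable_euclidean_ball.
  exact: measurable_funTS.
exact: euclidean_ballS.
Qed.

(** An open ball is the increasing union of the concentric balls of radii [r - 1/(n+1)]; monotone
    convergence does the rest. *)
Lemma integral_ball_shrink (c : \bar R) x r :
  c < \int[mu]_(y in euclidean_ball x r) g y ->
  exists2 s, (s < r)%R & c < \int[mu]_(y in euclidean_ball x s) g y.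
Proof.
move=> cr; apply: contrapT => noS.
pose F n : set (borel_rV R d) := euclidean_ball x (r - n.+1%:R^-1).
have Fr : \bigcup_n F n = euclidean_ball x r.
  apply/seteqP; split=> y.
    move=> [n _]; apply: euclidean_ballS.
    by rewrite subrr enorm0 add0r lerBlDr lerDl invr_ge0.
  rewrite euclidean_ballE => xy.
  have /ltr_add_invr[n] := xy.
  by rewrite -ltrBrDr => yn; exists n => //; rewrite /F euclidean_ballE.
have ndF : nondecreasing_seq F.
  move=> m n mn; rewrite subsetEset; apply: euclidean_ballS.
  by rewrite subrr enorm0 add0r lerB// lef_pV2 ?posrE// ler_nat.
have mgF n : measurable_fun (F n) g by exact: measurable_funTS.
have := @ge0_nondecreasing_set_cvg_integral _ _ _ F g mu ndF
  (fun n => measurable_euclidean_ball _ _) mgF (fun n y _ => g0 y).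
rewrite Fr => Fcvg.
move: cr; rewrite ltNge => /negP; apply.
rewrite -(cvg_lim _ Fcvg)//; apply: lime_le; first by apply/cvg_ex; eexists; exact: Fcvg.
apply: nearW => n; rewrite leNgt; apply/negP => cn; apply: noS.
by exists (r - n.+1%:R^-1)%R => //; rewrite ltrBlDr ltrDl invr_gt0.
Qed.

(** Pointwise, the restrictions of [g] to the sets [F i] add up to [g x] times the number of sets
    containing [x]. *)
Lemma integral_overlap (I : Type) (s : seq I) (F : I -> set (borel_rV R d))
    (N : nat) : (forall i, measurable (F i)) ->
    (forall z, (count (fun i => `[< F i z >]) s <= N)%N) ->
  \sum_(i <- s) \int[mu]_(x in F i) g x <= N%:R%:E * \int[mu]_x g x.
Proof.
move=> mF FN.
have mgF i : measurable_fun setT (g \_ (F i)).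
  by apply: (measurable_restrictT g (mF i)).1; exact: measurable_funTS.
under eq_bigr do rewrite integral_mkcond.
rewrite -ge0_integral_sum//; last first.
  by move=> i x _; apply: erestrict_ge0.
rewrite -ge0_integralZl_EFin//; apply: ge0_le_integral => //.
- by move=> x _; apply: sume_ge0 => i _; apply: erestrict_ge0.
- exact: emeasurable_sum.
- exact: measurable_funeM.
move=> x _; apply: (@le_trans _ _ ((count (fun i => `[< F i x >]) s)%:R%:E * g x)); last first.
  by rewrite lee_wpmul2r// lee_fin ler_nat.
elim: s {FN} => [|i s IH]; first by rewrite big_nil mul0e.
rewrite big_cons /= natrD EFinD ge0_muleDl ?lee_fin//.
apply: leeD => //; rewrite patchE.
case: asboolP => Fx; first by rewrite mem_set// mul1e.
by rewrite memNset// mul0e.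
Qed.

End weak_type.

(** [N] is the overlap bound, hence independent of [mu]. Points of [E] in a bounded region are
    covered by finitely many balls whose slightly shrunken copies still carry the large integral and
    overlap at most [N] times; the regions then exhaust [E]. *)
Lemma weak_type_bound {R : realType} {d : nat} : exists N : nat,
  forall (mu : {measure set (borel_rV R d) -> \bar R}) (g : borel_rV R d -> \bar R),
  measurable_fun setT g -> (forall x, 0 <= g x) ->
  forall (t : R) (E : set (borel_rV R d)), (0 < t)%R -> measurable E ->
  (forall x, E x -> exists r, t%:E * mu (euclidean_ball x r) <
                       \int[mu]_(y in euclidean_ball x r) g y) ->
  t%:E * mu E <= N%:R%:E * \int[mu]_y g y.
Proof.
have [N NP] := @bounded_overlap R d; exists N => mu g mg g0 t E t0 mE Et.
pose eta n : R := (n.+1%:R^-1)%R.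
have eta0 n : (0 < eta n)%R by rewrite invr_gt0.
(* The margin [eta n] lets finitely many centres serve: greedy selection uses radii [r - eta n], the
   covering uses radii [r]. *)
pose good n (x : 'rV[R]_d) r := t%:E * mu (euclidean_ball x r) <
  \int[mu]_(y in euclidean_ball x (r - eta n)) g y.
pose K n := [set x : 'rV[R]_d | (enorm x <= n%:R)%R /\ exists r, good n x r].
have /choice[U UP] : forall n, exists U : set (borel_rV R d), [/\ measurable U,
    (K n : set (borel_rV R d)) `<=` U & t%:E * mu U <= N%:R%:E * \int[mu]_y g y].
  move=> n.
  have [net [netK netP]] := finite_net _ _ _ (eta0 n)
    (fun x (Kx : K n x) => Kx.1).
  have /choice[r rP] : forall x, exists r, K n x -> good n x r.
    move=> x; have [[_ [r rx]]|nK] := pselect (K n x); first by exists r.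
    by exists 0%R.
  pose rho x := (r x - eta n)%R.
  have rho0 : {in net, forall x, (0 < rho x)%R}.
    move=> x /netK /rP; rewrite /good -/(rho x) ltNge => gx.
    rewrite ltNge; apply: contra gx => rho0.
    suff -> : euclidean_ball x (rho x) = set0.
      by rewrite integral_set0 mule_ge0// lee_fin ltW.
    apply/seteqP; split=> // y; rewrite euclidean_ballE => xy.
    by have := le_lt_trans (enorm_ge0 _) (lt_le_trans xy rho0); rewrite ltxx.
  have [s [snet ssep scov]] := greedy_selection _ (fun x => x) rho net rho0.
  exists (\big[setU/set0]_(x <- s) euclidean_ball x (r x)); split.
  - by apply: bigsetU_measurable => x _; exact: measurable_euclidean_ball.
  (* [x] is within [eta n] of a net point [c], which lies in a selected shrunken ball; so [x] lies
     in the full ball. *)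
  - move=> x /netP[c cnet xc]; have [i si ic] := scov c cnet.
    rewrite -bigcup_seq; exists i => //=; rewrite euclidean_ballE.
    have := ler_enorm_dist c i x; rewrite (enorm_distC c x).
    by move: ic xc; rewrite /rho; lra.
  - apply: le_trans (@integral_overlap _ _ mu g mg g0 _ s
      (fun x => euclidean_ball x (rho x)) N _ _); last 2 first.
    + by move=> x; exact: measurable_euclidean_ball.
    + move=> z; apply: leq_trans (NP _ _ _ _ ssep z).
      by apply: sub_count => i /asboolP; rewrite euclidean_ballE.
    apply: (@le_trans _ _ (t%:E * \sum_(x <- s) mu (euclidean_ball x (r x)))).
      rewrite lee_wpmul2l ?lee_fin ?(ltW t0)//.
      by apply: measure_bigsetU_le => x; exact: measurable_euclidean_ball.
    rewrite ge0_sume_distrr; last by move=> *; exact: measure_ge0.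
    rewrite big_seq [leRHS]big_seq; apply: lee_sum => x /snet/netK/rP.
    exact: ltW.
(* [K n] is not shown to be measurable, nor [U] to be monotone. The sets [V n] are measurable and
   increasing, which permits continuity of [mu] from below. *)
pose V n := \bigcap_(m in [set m | (n <= m)%N]) U m.
have mV n : measurable (V n).
  by apply: bigcap_measurable => [|m _]; [exists n => /=|have [] := UP m].
have EV : E `<=` \bigcup_n V n.
  move=> x /[dup] Ex /Et[r] /(integral_ball_shrink mu g mg g0) [s sr xs].
  have [n1 n1P] := ltr_add_invr sr.
  (* From this index on, [eta m] is at most [r - s] and [enorm x] at most [m], so [x] is in
     [K m]. *)
  exists (maxn n1 (Num.trunc (enorm x)).+1) => // m /=.
  rewrite geq_max => /andP[n1m xm].
  have [_ + _] := UP m; apply; split.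
    apply: le_trans (ltW (truncnS_gt _)) _.
    by rewrite ler_nat.
  exists r; apply: lt_le_trans xs _; apply: integral_ball_le => //.
  rewrite subrr enorm0 add0r lerBrDr; apply: le_trans (ltW n1P).
  by rewrite lerD2l lef_pV2 ?posrE// ler_nat.
have ndV : nondecreasing_seq V.
  move=> m n mn; rewrite subsetEset => x Vmx k /= nk.
  by apply: Vmx; exact: leq_trans nk.
have mbV : measurable (\bigcup_n V n) by exact: bigcup_measurable.
apply: (@le_trans _ _ (t%:E * mu (\bigcup_n V n))).
  by rewrite lee_wpmul2l ?lee_fin ?(ltW t0)// le_measure ?inE.
rewrite -lee_pdivlMl//.
have Vcvg : mu \o V @ \oo --> mu (\bigcup_n V n) by exact: nondecreasing_cvg_mu.
rewrite -(cvg_lim _ Vcvg)//; apply: lime_le.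
  by apply/cvg_ex; eexists; exact: Vcvg.
apply: nearW => n /=; rewrite lee_pdivlMl//.
have [mU _] := UP n; apply: le_trans.
rewrite lee_wpmul2l ?lee_fin ?(ltW t0)// le_measure ?inE//.
by apply: bigcap_inf => /=.
Qed.

(** * The maximal function, and bounded growth implies dichotomy *)

Section maximal_function.
Context {R : realType} {d : nat}.
Variable mu : {measure set (borel_rV R d) -> \bar R}.
Hypothesis mu_ball : forall (x : 'rV[R]_d) (r : R), (0 < r)%R ->
  0 < mu (euclidean_ball x r) < +oo.
Implicit Types (f : borel_rV R d -> R) (x y : 'rV[R]_d) (r t : R).

Lemma mu_ball_le x y r s : (enorm (x - y) + r <= s)%R ->
  mu (euclidean_ball x r) <= mu (euclidean_ball y s).
Proof.
move=> xys; apply: le_measure; rewrite ?inE; try exact: measurable_euclidean_ball.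
exact: euclidean_ballS.
Qed.

Lemma mu_ballE x r : (0 < r)%R ->
  exists2 m : R, (0 < m)%R & mu (euclidean_ball x r) = m%:E.
Proof.
move=> /(mu_ball x); case: (mu _) => [m| |]; rewrite ?ltxx ?andbF//.
by rewrite lte_fin => /andP[m0 _]; exists m.
Qed.

Lemma lt_averageE x r t (I : \bar R) : (0 < r)%R ->
  (t%:E < (mu (euclidean_ball x r))^-1 * I) = (t%:E * mu (euclidean_ball x r) < I).
Proof.
move=> /(mu_ballE x)[m m0 ->].
by rewrite inver gt_eqF// lte_pdivlMl// muleC.
Qed.

Lemma lt_maximalP f x t : t%:E < centered_maximal mu f x <->
  exists2 r, (0 < r)%R & t%:E * mu (euclidean_ball x r) <
    \int[mu]_(y in euclidean_ball x r) `|f y|%:E.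
Proof.
split=> [/ereal_sup_gt[_ /= [r r0 <-]]|[r r0]].
  by rewrite lt_averageE// => ?; exists r.
by rewrite -lt_averageE//; move/lt_le_trans; apply; apply: ereal_sup_ubound; exists r.
Qed.

Lemma measurable_abse_fun f : measurable_fun [set: borel_rV R d] f ->
  measurable_fun setT (fun y : borel_rV R d => `|f y|%:E).
Proof. by move=> mf; apply/measurable_EFinP; exact: measurableT_comp. Qed.

(** A witnessing radius [r] at [x] can be shrunk to [s] in the integral alone. For [y] within
    [(r - s) / 2] of [x], the ball about [y] of radius [(r + s) / 2] contains the ball of radius [s]
    about [x] and lies in that of radius [r]. *)
Lemma open_lt_maximal f t : (0 <= t)%R -> measurable_fun [set: borel_rV R d] f ->
  open ([set x | t%:E < centered_maximal mu f x] : set 'rV[R]_d).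
Proof.
move=> t0 mf; rewrite openE => x /= /lt_maximalP[r r0 tr].
have f0 (y : borel_rV R d) : 0 <= `|f y|%:E by rewrite lee_fin.
have [s sr ts] := integral_ball_shrink _ _ (measurable_abse_fun f mf) f0 _ _ _ tr.
have s0 : (0 < s)%R.
  rewrite ltNge; apply/negP => s0; move: ts; rewrite ltNge => /negP; apply.
  suff -> : euclidean_ball x s = set0.
    by rewrite integral_set0 mule_ge0// lee_fin.
  apply/seteqP; split=> // y; rewrite euclidean_ballE => xy.
  by have := le_lt_trans (enorm_ge0 _) (lt_le_trans xy s0); rewrite ltxx.
pose e := ((r - s) / 2)%R.
have e0 : (0 < e)%R by rewrite /e; lra.
apply: (@filterS _ _ _ (euclidean_ball x e : set 'rV[R]_d)); last first.
  apply: open_nbhs_nbhs; split; first exact: open_euclidean_ball.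
  by rewrite euclidean_ballE subrr enorm0.
move=> y; rewrite euclidean_ballE => xy /=.
apply/lt_maximalP; exists (s + e)%R; first lra.
apply: (@le_lt_trans _ _ (t%:E * mu (euclidean_ball x r))).
  rewrite lee_wpmul2l ?lee_fin//; apply: mu_ball_le.
  by rewrite enorm_distC /e in xy *; lra.
apply: lt_le_trans ts _; apply: integral_ball_le => //.
  exact: measurable_abse_fun.
by rewrite addrC lerD2l ltW.
Qed.

Lemma measurable_infinity_set f : measurable_fun [set: borel_rV R d] f ->
  measurable (infinity_set mu f).
Proof.
move=> mf.
have -> : infinity_set mu f =
    \bigcap_n ([set x | n%:R%:E < centered_maximal mu f x] : set (borel_rV R d)).
  apply/seteqP; split=> x /=; first by move=> fx n _ /=; rewrite fx ltry.
  move=> fx; apply/eqyP => A A0.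
  apply: le_trans (ltW (fx (Num.trunc A).+1 I)).
  by rewrite lee_fin ltW// truncnS_gt.
apply: bigcap_measurable => // n _; apply: sub_sigma_algebra.
exact: open_lt_maximal.
Qed.

(** The finite limsup without quotients. The bound [0 <= r0] keeps all radii positive, and [1 <= C]
    allows the estimate to be iterated. *)
Definition bounded_growth (y0 : 'rV[R]_d) := exists C r0 : R,
  [/\ (1 <= C)%R, (0 <= r0)%R & forall r, (r0 < r)%R ->
    mu (euclidean_ball y0 (r + 1)) <= C%:E * mu (euclidean_ball y0 r)].

Lemma limf_esup_growthP y0 :
  limf_esup (fun r : R => mu (euclidean_ball y0 (r + 1)) /
                          mu (euclidean_ball y0 r)) (pinfty_nbhs R) < +oo <->
  bounded_growth y0.
Proof.
rewrite limf_esupE; split.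
- move=> /ereal_inf_lt[_ [V [r0 [_ Vr0]] <-]] supV.
  have [C C1 supC] : exists2 C : R, (1 <= C)%R &
      ereal_sup [set mu (euclidean_ball y0 (r + 1)) /
                          mu (euclidean_ball y0 r) | r in V] <= C%:E.
    move: supV; case: (ereal_sup _) => [s| |]//= _.
      by exists (Num.max 1 s)%R; rewrite ?lee_fin le_max lexx ?orbT.
    by exists 1%R; rewrite ?leNye.
  exists C, (Num.max 0 r0)%R; split=> //; first by rewrite le_max lexx.
  move=> r; rewrite gt_max => /andP[rgt0 /Vr0 Vr].
  have : mu (euclidean_ball y0 (r + 1)) / mu (euclidean_ball y0 r) <= C%:E.
    by apply: le_trans supC; apply: ereal_sup_ubound; exists r.
  have [m m0 ->] := mu_ballE y0 r rgt0.
  by rewrite inver gt_eqF// lee_pdivrMr.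
- move=> [C [r0 [C1 r0_ge0 growth]]].
  apply: (@le_lt_trans _ _ C%:E); last exact: ltry.
  apply: (@le_trans _ _ (ereal_sup [set mu (euclidean_ball y0 (r + 1)) /
                          mu (euclidean_ball y0 r) | r in [set r | (r0 < r)%R]])).
    apply: ereal_inf_lbound => /=; exists [set r | (r0 < r)%R] => //.
    by exists r0; split=> //; exact: num_real.
  apply: ge_ereal_sup => _ /= [r r0r <-].
  have [m m0 mE] := mu_ballE y0 r (le_lt_trans r0_ge0 r0r).
  have := growth r r0r; rewrite mE.
  by rewrite inver gt_eqF// lee_pdivrMr.
Qed.

Lemma growth_iter y0 C r0 : (1 <= C)%R ->
  (forall r, (r0 < r)%R ->
    mu (euclidean_ball y0 (r + 1)) <= C%:E * mu (euclidean_ball y0 r)) ->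
  forall (k : nat) r, (r0 < r)%R ->
    mu (euclidean_ball y0 (r + k%:R)) <= (C ^+ k)%:E * mu (euclidean_ball y0 r).
Proof.
move=> C1 growth; elim=> [|k IH] r r0r.
  by rewrite addr0 expr0 mul1e.
rewrite -natr1 addrA; apply: le_trans (growth _ _) _.
  by apply: lt_le_trans r0r _; rewrite lerDl.
rewrite exprS EFinM -muleA lee_wpmul2l//; last exact: IH.
by rewrite lee_fin (le_trans _ C1).
Qed.

Lemma measure_eq0_of_large (A : set (borel_rV R d)) (t0 : R) (c : \bar R) : 
  0 <= c < +oo -> (forall t, (t0 <= t)%R -> t%:E * mu A <= c) -> mu A = 0.
Proof.
move=> /andP[c0 cy] tA; apply/eqP; rewrite eq_le measure_ge0 andbT leNgt.
apply/negP => A0; have c_fin : c \is a fin_num by rewrite ge0_fin_numE.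
move: c c_fin c0 cy tA => [c| |]//= _; rewrite lee_fin => c0 _ tA.
case: (mu A) A0 tA => [m| |]//; last first.
  (* If [mu A] is infinite, a positive [t] is needed to contradict finiteness of [c], and [t0] may
     be negative. *)
  move=> _ /(_ (Num.max 1 t0)%R); rewrite le_max lexx orbT => /(_ isT).
  by rewrite mulry gtr0_sg ?mul1e ?leye_eq// lt_max ltr01.
rewrite lte_fin => m0 /(_ (Num.max t0 ((c + 1) / m))%R).
rewrite le_max lexx => /(_ isT); rewrite -EFinM lee_fin => cm.
have : ((c + 1) / m * m <= c)%R.
  by apply: le_trans cm; rewrite ler_pM2r// le_max lexx orbT.
rewrite divfK ?gt_eqF//; lra.
Qed.

Lemma measure_eq0_of_balls (A : set (borel_rV R d)) : measurable A ->
  (forall n : nat, mu (A `&` euclidean_ball 0 n%:R) = 0) -> mu A = 0.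
Proof.
move=> mA An0; apply/negligibleP => //.
have -> : A = \bigcup_n (A `&` euclidean_ball 0 n%:R).
  apply/seteqP; split=> [x Ax|x [n _ []//]].
  exists (Num.trunc (enorm x)).+1 => //; split=> //.
  by rewrite euclidean_ballE sub0r enormN truncnS_gt.
apply: negligible_bigcup => n; apply/negligibleP; last exact: An0.
by apply: measurableI => //; exact: measurable_euclidean_ball.
Qed.

Lemma dichotomy_of_growth y0 : bounded_growth y0 -> dichotomy_property mu.
Proof.
move=> [C [r0 [C1 r0_ge0 growth]]] f [mf f_loc].
have [->|] := pselect (infinity_set mu f = setT); first by right.
rewrite -subTset => /nonsubset[x0 [_ fx0]]; left.
have maf := measurable_abse_fun f mf.
have af0 (y : borel_rV R d) : 0 <= `|f y|%:E by rewrite lee_fin.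
have [A A0 fA] : exists2 A : R, (0 <= A)%R & forall r, (0 < r)%R ->
    \int[mu]_(y in euclidean_ball x0 r) `|f y|%:E <= A%:E * mu (euclidean_ball x0 r).
  have : centered_maximal mu f x0 < +oo by rewrite ltey; apply/eqP.
  case fE : (centered_maximal mu f x0) => [a| |]// _.
    exists (Num.max 0 a)%R; rewrite ?le_max ?lexx// => r r0'.
    rewrite leNgt; apply/negP => ar.
    have /lt_maximalP : exists2 r, (0 < r)%R &
        (Num.max 0 a)%:E * mu (euclidean_ball x0 r) <
        \int[mu]_(y in euclidean_ball x0 r) `|f y|%:E by exists r.
    by rewrite fE lte_fin gt_max ltxx andbF.
  exists 0%R => // r r0'; rewrite leNgt; apply/negP => ar.
  have /lt_maximalP : exists2 r, (0 < r)%R &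
      0%:E * mu (euclidean_ball x0 r) <
      \int[mu]_(y in euclidean_ball x0 r) `|f y|%:E by exists r.
  by rewrite fE.
have mE := measurable_infinity_set f mf.
suff En0 n : mu (infinity_set mu f `&` euclidean_ball 0 n%:R) = 0.
  exact: measure_eq0_of_balls.
(* [D] bounds the distances between [x0], [y0] and points [x] with [enorm x < n]. Passing from [x]
   to [x0] to [y0] enlarges the radius by at most [2 * D], and a ball about [y0] fits back into the
   one about [x] at radius [r - D]: fewer than [k] unit steps of growth, starting above [r0] as
   [r1 < r]. *)
pose D := (n%:R + enorm x0 + enorm y0 + 1)%R.
have [nx0 ny0 nn] : [/\ 0 <= enorm x0, 0 <= enorm y0 & 0 <= n%:R :> R]%R.
  by rewrite !enorm_ge0.
pose k := (Num.trunc (3 * D)).+1.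
have kD : (3 * D < k%:R)%R by exact: truncnS_gt.
pose r1 := (D + r0)%R.
have large x r : (enorm x < n%:R)%R -> (r1 < r)%R ->
    \int[mu]_(y in euclidean_ball x r) `|f y|%:E <=
    (A * C ^+ k)%:E * mu (euclidean_ball x r).
  move=> xn r1r.
  have xx0 := ler_enormD x (- x0); have x0y0 := ler_enormD x0 (- y0).
  have yx0 := ler_enormD y0 (- x); rewrite !enormN in xx0 x0y0 yx0.
  apply: (@le_trans _ _ (\int[mu]_(y in euclidean_ball x0 (r + D)) `|f y|%:E)).
    by apply: integral_ball_le => //; rewrite /D; lra.
  apply: le_trans (fA _ _) _; first by rewrite /r1 /D in r1r *; lra.
  rewrite EFinM -muleA lee_wpmul2l ?lee_fin//.
  apply: (@le_trans _ _ ((C ^+ k)%:E * mu (euclidean_ball y0 (r - D)))).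
    apply: le_trans (growth_iter y0 C r0 C1 growth k _ _); last first.
      by rewrite /r1 in r1r; lra.
    by apply: mu_ball_le; rewrite /D in kD *; lra.
  rewrite lee_wpmul2l ?lee_fin ?exprn_ge0 ?(le_trans _ C1)//.
  by apply: mu_ball_le; rewrite /D; lra.
have [N NP] := @weak_type_bound R d.
(* [B0] contains every ball of radius at most [r1] centred at norm less than [n], so the truncation
   [g] is integrable and has the same integrals over those balls. *)
pose B0 : set (borel_rV R d) := euclidean_ball 0 (n%:R + r1).
have mB0 : measurable B0 by exact: measurable_euclidean_ball.
pose g := (fun y : borel_rV R d => `|f y|%:E) \_ B0.
have mg : measurable_fun setT g.
  by apply: (measurable_restrictT _ mB0).1; exact: measurable_funTS.
have g0 x : 0 <= g x by exact: erestrict_ge0.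
have I_fin : 0 <= N%:R%:E * \int[mu]_y g y < +oo.
  have Iy : \int[mu]_y g y < +oo.
    by rewrite /g -integral_mkcond; apply: f_loc; rewrite /r1 /D; lra.
  have I0 : 0 <= \int[mu]_y g y by exact: integral_ge0.
  by rewrite mule_ge0// lte_mul_pinfty.
(* For [t] at least [A * C ^+ k], the estimate [large] excludes radii above [r1] as witnesses. *)
apply: (measure_eq0_of_large _ (Num.max 1 (A * C ^+ k))%R _ I_fin) => t; rewrite ge_max => /andP[t1 tA].
apply: NP => //.
- exact: lt_le_trans ltr01 t1.
- by apply: measurableI => //; exact: measurable_euclidean_ball.
move=> x [fx]; rewrite euclidean_ballE sub0r enormN => xn.
have /lt_maximalP[r r_gt0 tr] : t%:E < centered_maximal mu f x.
  by rewrite fx ltry.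
have rr1 : (r <= r1)%R.
  rewrite leNgt; apply/negP => /(large _ _ xn).
  rewrite leNgt => /negP; apply; apply: le_lt_trans tr.
  by rewrite lee_wpmul2r// lee_fin.
exists r.
have xrB0 : euclidean_ball x r `<=` B0.
  by apply: euclidean_ballS; rewrite subr0; exact: lerD (ltW xn) rr1.
by rewrite /g -integral_mkcondr (setIidl xrB0).
Qed.

End maximal_function.

(** * Failure of growth destroys dichotomy *)

Section counterexample.
Context {R : realType} {d : nat}.
Variable mu : {measure set (borel_rV R d) -> \bar R}.
Hypothesis mu_ball : forall (x : 'rV[R]_d) (r : R), (0 < r)%R ->
  0 < mu (euclidean_ball x r) < +oo.
Implicit Types (e x y z : 'rV[R]_d) (r t : R).

(* The annulus between the spheres of radii r - 1 and r + 1 about 0 is covered by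
   the balls of radius r - 1 about 4 e, with e in a 1/2-net of the unit sphere. *)
Lemma far_direction : (0 < d)%N -> ~ bounded_growth mu 0 ->
  exists2 e, enorm e = 1%R & forall C r0, exists2 r, (r0 < r)%R &
    C%:E * mu (euclidean_ball 0 r) < mu (euclidean_ball (4 *: e) (r - 1)).
Proof.
move=> d0 nogrowth; apply: contrapT => nodir.
have /choice[C CP] : forall e, exists C : R, enorm e = 1%R -> exists r0 : R,
    forall r, (r0 < r)%R ->
    mu (euclidean_ball (4 *: e) (r - 1)) <= C%:E * mu (euclidean_ball 0 r).
  move=> e; have [e1|] := eqVneq (enorm e) 1%R; last by move=> /eqP ?; exists 0%R.
  apply: contrapT => noC; apply: nodir; exists e => // C r0.
  apply: contrapT => nor; apply: noC; exists C => _; exists r0 => r r0r.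
  by rewrite leNgt; apply/negP => Cr; apply: nor; exists r.
have /choice[r0 r0P] : forall e, exists r0 : R, enorm e = 1%R ->
    forall r, (r0 < r)%R ->
    mu (euclidean_ball (4 *: e) (r - 1)) <= (C e)%:E * mu (euclidean_ball 0 r).
  move=> e; have [e1|] := eqVneq (enorm e) 1%R; last by move=> /eqP ?; exists 0%R.
  by have [r0 r0P] := CP e e1; exists r0.
have [|//|s [s1 sP]] := @finite_net R d [set u | enorm u = 1%R] 1 2^-1.
  by rewrite invr_gt0.
  by move=> x /= ->.
have one_neq0 : const_mx 1%R != 0%R :> 'rV[R]_d.
  apply/eqP => /rowP/(_ (Ordinal d0)); rewrite !mxE => /eqP.
  by rewrite oner_eq0.
(* The sum of the [C c] bounds the measure of the union of the covering balls; the other sum exceeds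
   every threshold [r0 c], and 9 leaves room for the geometry. *)
apply: nogrowth; exists (1 + \sum_(c <- s) `|C c|)%R, (9 + \sum_(c <- s) `|r0 c|)%R.
split.
- by rewrite lerDl sumr_ge0.
- by rewrite addr_ge0 ?sumr_ge0.
move=> r rs.
have r9 : (9 < r)%R.
  by apply: le_lt_trans rs; rewrite lerDl sumr_ge0.
have r0r c : c \in s -> (r0 c < r)%R.
  move=> cs; apply: le_lt_trans rs.
  rewrite (big_rem c)//= addrCA; apply: le_trans (ler_norm _) _.
  by rewrite lerDl addr_ge0// sumr_ge0.
pose U := \big[setU/set0]_(c <- s) euclidean_ball (4 *: c) (r - 1).
(* For nonzero [z] with direction [u] and a net point [c] within 1/2 of [u], [4 *: c] is within 2 of
   [4 *: u], which is within [r - 3] of [z]. For [z = 0] any net point serves. *)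
have BU : euclidean_ball 0 (r + 1) `<=` U.
  move=> z; rewrite euclidean_ballE sub0r enormN => zr.
  have [c cs cz] : exists2 c, c \in s & (enorm (4 *: c - z) < r - 1)%R.
    have [->|z0] := eqVneq z 0%R.
      have [c cs _] := sP _ (enorm_unit _ one_neq0); exists c => //.
      by rewrite subr0 enormZ (s1 _ cs) mulr1 ger0_norm//; lra.
    have [c cs zc] := sP _ (enorm_unit _ z0); exists c => //.
    set u := _ *: z in zc.
    have zu : z = enorm z *: u.
      by rewrite /u scalerA mulfV ?scale1r// enorm_eq0.
    have u1 : enorm u = 1%R by exact: enorm_unit.
    clearbody u; have := ler_enorm_dist (4 *: u) (4 *: c) z.
    rewrite -scalerBr {2}zu -scalerBl !enormZ u1 mulr1.
    rewrite (enorm_distC c) (@ger0_norm _ 4%R)//.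
    have : (`|4 - enorm z| <= r - 3)%R.
      rewrite ler_norml; have := enorm_ge0 z; lra.
    lra.
  by rewrite /U -bigcup_seq; exists c => //=; rewrite euclidean_ballE.
have mU c : measurable (euclidean_ball (4 *: c : 'rV[R]_d) (r - 1)).
  exact: measurable_euclidean_ball.
apply: (@le_trans _ _ (mu U)).
  apply: le_measure => //; rewrite inE; first exact: measurable_euclidean_ball.
  by rewrite /U; exact: bigsetU_measurable.
apply: le_trans (measure_bigsetU_le _ _ _ _ mU) _.
apply: (@le_trans _ _ (\sum_(c <- s) `|C c|%:E * mu (euclidean_ball 0 r))).
  rewrite big_seq [leRHS]big_seq; apply: lee_sum => c cs.
  apply: le_trans (r0P c (s1 _ cs) r (r0r _ cs)) _.
  by rewrite lee_wpmul2r// lee_fin ler_norm.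
rewrite -ge0_sume_distrl; last by move=> c _; rewrite lee_fin.
by rewrite lee_wpmul2r// sumEFin lee_fin lerDr.
Qed.

Section series.
Variables (e : 'rV[R]_d) (r : nat -> R).
Hypotheses (e1 : enorm e = 1%R) (r_gt : forall k, (k%:R + 2 < r k)%R).
Hypothesis far : forall k, (k%:R * 2 ^+ k.+1)%:E * mu (euclidean_ball 0 (r k)) <
  mu (euclidean_ball (4 *: e) (r k - 1)).

(** The centre is at distance [r k + 3] from [4 *: e] but [r k - 1] from 0. The heights give bump
    [k] the integral [far_mass k / 2 ^ k.+1]. *)
Let bump k := euclidean_ball (- (r k - 1) *: e) 2^-1.
Let far_mass k := fine (mu (euclidean_ball (4 *: e) (r k - 1))).
Let height k := (far_mass k / (2 ^ k.+1)%:R / fine (mu (bump k)))%R.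
Let F (x : borel_rV R d) : \bar R := \sum_(k <oo) (height k)%:E * (\1_(bump k) x)%:E.

Let r_gt2 k : (2 < r k)%R.
Proof. by apply: le_lt_trans (r_gt k); rewrite lerDr. Qed.

Let far_massE k : mu (euclidean_ball (4 *: e) (r k - 1)) = (far_mass k)%:E.
Proof.
rewrite /far_mass; have [|m m0 ->//] := mu_ballE mu mu_ball (4 *: e) (r k - 1).
by have := r_gt2 k; lra.
Qed.

Let height_ge0 k : (0 <= height k)%R.
Proof.
by rewrite /height !divr_ge0// fine_ge0.
Qed.

Let mu_height k : (height k)%:E * mu (bump k) = (far_mass k / (2 ^ k.+1)%:R)%:E.
Proof.
rewrite /height; have [|m m0 ->] := mu_ballE mu mu_ball (- (r k - 1) *: e) 2^-1.
  by rewrite invr_gt0.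
by rewrite -EFinM /= divfK// gt_eqF.
Qed.

Let m_bump k : measurable (bump k).
Proof. exact: measurable_euclidean_ball. Qed.

Let m_term k : measurable_fun setT (fun x : borel_rV R d => (height k)%:E * (\1_(bump k) x)%:E).
Proof.
apply: measurable_funeM; apply/measurable_EFinP; exact: measurable_indic.
Qed.

Let term_ge0 k (x : borel_rV R d) : 0 <= (height k)%:E * (\1_(bump k) x)%:E.
Proof. by rewrite mule_ge0 ?lee_fin. Qed.

Let mF : measurable_fun setT F.
Proof. by apply: ge0_emeasurable_sum => [k x _ _|k _]; [exact: term_ge0|exact: m_term]. Qed.

Let F_ge0 x : 0 <= F x.
Proof. by apply: nneseries_ge0 => k _ _; exact: term_ge0. Qed.

Let enorm_center k : enorm (- (r k - 1) *: e) = (r k - 1)%R.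
Proof. by rewrite enormZ e1 mulr1 normrN ger0_norm//; have := r_gt2 k; lra. Qed.

(** Bump [k] lies outside the ball of radius [k] about 0, so only finitely many terms are nonzero at
    [x]. *)
Let F_fin x : F x \is a fin_num.
Proof.
pose n := (Num.trunc (enorm x)).+1.
rewrite /F (@nneseries_split _ _ 0 n) => [|k _]; last exact: term_ge0.
rewrite add0n eseries0 ?adde0 => [|k nk _].
  by apply/sum_fin_numP => k _ _; rewrite -EFinM.
rewrite indicE memNset ?mule0// /bump euclidean_ballE => xk.
have := ler_enorm_dist x (- (r k - 1) *: e) 0%R.
rewrite !subr0 enorm_center; have := r_gt k.
have : (enorm x < k%:R)%R.
  by apply: lt_le_trans (truncnS_gt _) _; rewrite ler_nat.
by move: xk; lra.
Qed.

Let f (x : borel_rV R d) : R := fine (F x).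

Let mf : measurable_fun [set: borel_rV R d] f.
Proof. by apply: (@measurableT_comp _ _ _ _ _ _ fine _ F); [exact: fine_measurable|exact: mF]. Qed.

Let integral_normf (D : set (borel_rV R d)) : measurable D ->
  \int[mu]_(x in D) `|f x|%:E = \sum_(k <oo) (height k)%:E * mu (bump k `&` D).
Proof.
move=> mD; transitivity (\int[mu]_(x in D) F x).
  apply: eq_integral => x _; rewrite /f ger0_norm ?fine_ge0//; exact: fineK.
rewrite integral_nneseries//; last first.
  by move=> k; apply: measurable_funTS; exact: m_term.
apply: eq_eseriesr => k _.
rewrite ge0_integralZl_EFin//; last first.
  by apply: measurable_funTS; apply/measurable_EFinP; exact: measurable_indic.
by rewrite integral_indic.
Qed.

(** A bump meeting the ball of radius [s] about [4 *: e] has [r k - 1 <= s]. Its integral is then at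
    most the measure of that ball over [2 ^ k.+1], and these bounds sum to the measure. *)
Let integral_near s : (0 < s)%R ->
  \int[mu]_(x in euclidean_ball (4 *: e) s) `|f x|%:E <=
  mu (euclidean_ball (4 *: e) s).
Proof.
move=> s0; rewrite integral_normf; last exact: measurable_euclidean_ball.
have [m m0 mE] := mu_ballE mu mu_ball (4 *: e) s s0; rewrite [leRHS]mE.
apply: le_trans (epsilon_trick0 xpredT (ltW m0)).
apply: lee_nneseries => k _; first by rewrite mule_ge0 ?lee_fin.
set B := euclidean_ball _ _ in mE *.
have mB : measurable B by exact: measurable_euclidean_ball.
have [->|] := pselect (bump k `&` B = set0).
  by rewrite measure0 mule0 lee_fin divr_ge0// ltW.
move=> /eqP/set0P[z []]; rewrite /B /bump !euclidean_ballE => kz sz.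
have rks : (r k - 1 <= s)%R.
  have := ler_enorm_dist z (4 *: e) (- (r k - 1) *: e).
  rewrite -scalerBl enormZ e1 mulr1 (enorm_distC z).
  have r2 := r_gt2 k; rewrite ger0_norm; lra.
apply: (@le_trans _ _ ((height k)%:E * mu (bump k))).
  rewrite lee_wpmul2l ?lee_fin//; apply: le_measure; rewrite ?inE.
  - by apply: measurableI; [exact: m_bump|exact: mB].
  - exact: m_bump.
  - exact: subIsetl.
rewrite mu_height lee_fin ler_pM2r ?invr_gt0 ?ltr0n ?expn_gt0//.
by rewrite -lee_fin -far_massE -mE; apply: mu_ball_le; rewrite subrr enorm0 add0r.
Qed.

Let L1_loc_f : L1_loc mu f.
Proof.
split=> // x s s0.
pose s' := (enorm (x - 4 *: e) + s)%R.
have s'0 : (0 < s')%R by rewrite ltr_wpDl// enorm_ge0.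
apply: (@le_lt_trans _ _ (\int[mu]_(y in euclidean_ball (4 *: e) s') `|f y|%:E)).
  by apply: integral_ball_le => //; exact: measurable_abse_fun.
apply: le_lt_trans (integral_near _ s'0) _.
by have /andP[] := mu_ball (4 *: e) s' s'0.
Qed.

Let maximal_near : centered_maximal mu f (4 *: e) <= 1.
Proof.
rewrite leNgt; apply/negP => /(lt_maximalP mu mu_ball)[s s0].
by rewrite mul1e ltNge integral_near.
Qed.

(** The ball about [x] of radius [r k - 1/4] contains bump [k] and lies in the ball of radius [r k]
    about 0. By [far], the average over it exceeds [k]. *)
Let maximal_far x : (enorm x < 4^-1)%R -> centered_maximal mu f x = +oo.
Proof.
move=> x4; apply/eqyP => A A0; apply: ltW.
pose k := (Num.trunc A).+1.
apply: (@lt_trans _ _ k%:R%:E); first by rewrite lte_fin truncnS_gt.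
have r2 := r_gt2 k.
apply/(lt_maximalP mu mu_ball); exists (r k - 4^-1)%R; first lra.
set B := euclidean_ball _ _.
have mB : measurable B by exact: measurable_euclidean_ball.
have bumpB : bump k `<=` B.
  apply: euclidean_ballS.
  have := ler_enormD (- (r k - 1) *: e) (- x).
  by rewrite enorm_center enormN; lra.
apply: (@lt_le_trans _ _ ((height k)%:E * mu (bump k))); last first.
  rewrite integral_normf// -{1}(setIidl bumpB).
  (* The partial sum up to [k.+1] has the term of bump [k] as its last one. *)
  apply: le_trans (nneseries_lim_ge k.+1 _); last first.
    by move=> n _ _; rewrite mule_ge0 ?lee_fin.
  rewrite big_nat_recr//= leeDr// sume_ge0// => n _.
  by rewrite mule_ge0 ?lee_fin.
apply: (@le_lt_trans _ _ (k%:R%:E * mu (euclidean_ball 0 (r k)))).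
  rewrite lee_wpmul2l ?lee_fin//; apply: mu_ball_le.
  by rewrite subr0; lra.
have := far k; rewrite mu_height far_massE.
have [|m m0 ->] := mu_ballE mu mu_ball 0 (r k); first lra.
rewrite -!EFinM !lte_fin ltr_pdivlMr ?ltr0n ?expn_gt0// natrX.
by rewrite mulrAC.
Qed.

(** The infinity set contains the ball of radius 1/4 about 0, of positive measure, yet misses
    [4 *: e]. *)
Lemma far_not_dichotomy : ~ dichotomy_property mu.
Proof.
move=> /(_ f L1_loc_f)[|/seteqP[_ E]].
  have /andP[+ _] := mu_ball 0%R 4^-1 (ltac:(by rewrite invr_gt0) : (0 < 4^-1 :> R)%R).
  move=> /[swap] E0; rewrite ltNge -E0 => /negP; apply.
  apply: le_measure; rewrite ?inE.
  - exact: measurable_euclidean_ball.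
  - exact: measurable_infinity_set.
  - move=> x; rewrite euclidean_ballE sub0r enormN => x4.
    exact: maximal_far.
have := E (4 *: e) Logic.I; rewrite /infinity_set /= => Ey.
by move: maximal_near; rewrite Ey.
Qed.

End series.

Lemma growth_of_dichotomy : (0 < d)%N -> dichotomy_property mu ->
  bounded_growth mu 0.
Proof.
move=> d0 dich; apply: contrapT => /(far_direction d0)[e e1 far].
(* The factor [2 ^+ k.+1] pays for the weight of the bump and leaves [k] for the average;
   [k + 2 < r] drives the bumps to infinity. *)
have /choice[r rP] : forall k : nat, exists r : R, (k%:R + 2 < r)%R /\
    (k%:R * 2 ^+ k.+1)%:E * mu (euclidean_ball 0 r) <
    mu (euclidean_ball (4 *: e) (r - 1)).
  by move=> k; have [r] := far (k%:R * 2 ^+ k.+1)%R (k%:R + 2)%R; exists r.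
exact: (far_not_dichotomy e r e1 (fun k => (rP k).1) (fun k => (rP k).2)).
Qed.

End counterexample.

Theorem theorem2 (R : realType) (d : nat) (hd : (1 <= d)%N)
    (mu : {measure set (borel_rV R d) -> \bar R})
    (hmu : forall (x : 'rV[R]_d) (r : R), (0 < r)%R ->
       0 < mu (euclidean_ball x r) < +oo) :
  dichotomy_property mu <->
  exists y0 : 'rV[R]_d,
    limf_esup (fun r : R => mu (euclidean_ball y0 (r + 1)%R) /
                            mu (euclidean_ball y0 r))
              (pinfty_nbhs R) < +oo.
Proof.
split=> [dich|[y0 y0_growth]].
  (* Dichotomy gives growth at the origin, while the converse accepts any centre. *)
  exists 0%R; apply/(limf_esup_growthP mu hmu).
  exact: growth_of_dichotomy.
by apply: (dichotomy_of_growth mu hmu y0); apply/(limf_esup_growthP mu hmu).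
Qed.
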